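(* Let $n,r\ge1$, $A_{-1}\in\mathbb{R}^{n\times n}$, $B\in\mathbb{R}^{n\times r}$, and let $A_2,A_3$ be $n\times n$ matrix functions on $[-1,0]$ with entries in $L_2([-1,0],\mathbb{C})$. Consider the neutral type system $$\dot z(t)=A_{-1}\dot z(t-1)+\int_{-1}^0A_2(\theta)\dot z(t+\theta)\,d\theta+\int_{-1}^0A_3(\theta)z(t+\theta)\,d\theta+Bu(t)$$ and its operator model $\dot x=\mathcal A x+\mathcal B u$ on $M_2$ described in the context. If the pair $(A_{-1},B)$ is not controllable, i.e. $\operatorname{rank}(B\ \ A_{-1}B\ \cdots\ A_{-1}^{n-1}B)<n$ (equivalently, there exist $\mu\in\sigma(A_{-1})$ and $y\in\mathbb{C}^n\setminus\{0\}$ with $A_{-1}^*y=\bar\mu y$ and $B^*y=0$), then the system is not exactly controllable at any time, i.e. $\mathcal R_T\neq\mathcal D(\mathcal A)$ for every $T>0$. (No assumption on invertibility of $A_{-1}$ is made.)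
   Context: The state space is $M_2=\mathbb{C}^n\times L_2(-1,0;\mathbb{C}^n)$. The operator $\mathcal A$ is defined by $\mathcal A(y,z(\cdot))=\big(Lz,\ \tfrac{d}{d\theta}z\big)$, where $Lz=\int_{-1}^0A_2(\theta)z'(\theta)\,d\theta+\int_{-1}^0A_3(\theta)z(\theta)\,d\theta$, on the domain $\mathcal D(\mathcal A)=\{(y,z(\cdot))\in M_2: z\in H^1(-1,0;\mathbb{C}^n),\ y=z(0)-A_{-1}z(-1)\}$; $\mathcal A$ generates a $C_0$-semigroup $e^{\mathcal At}$ on $M_2$. The control operator is $\mathcal Bu=(Bu,0)$ for $u\in\mathbb{C}^r$. The reachability set from $0$ at time $T$ is $\mathcal R_T=\{\int_0^Te^{\mathcal At}\mathcal Bu(t)\,dt: u\in L_2(0,T;\mathbb{C}^r)\}$. The system is exactly controllable at time $T$ if $\mathcal R_T=\mathcal D(\mathcal A)$ (equivalently, the set of restrictions to $[T-1,T]$ of solutions with zero initial data on $[-1,0]$, over all controls $u\in L_2(0,T;\mathbb{C}^r)$, equals $H^1(T-1,T;\mathbb{C}^n)$). *)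

(* Defs.v *)
From HB Require Import structures.
From mathcomp Require Import all_boot all_order all_algebra.
From mathcomp Require Import all_classical all_reals all_analysis.
From mathcomp Require Import complex.

Set Implicit Arguments.
Unset Strict Implicit.
Unset Printing Implicit Defensive.

Import Order.TTheory GRing.Theory Num.Theory.
Local Open Scope classical_set_scope.
Local Open Scope ring_scope.

Section NeutralDefs.
Variable R : realType.
Local Notation C := (complex R).
Local Notation mu := (@lebesgue_measure R).

Definition L2r (D : set R) (f : R -> R) : Prop :=
  measurable_fun D f /\ (\int[mu]_(x in D) ((f x) ^+ 2)%:E < +oo)%E.

Definition L2c (D : set R) (h : R -> C) : Prop :=
  L2r D (fun x => complex.Re (h x)) /\ L2r D (fun x => complex.Im (h x)).

Definition L2v m (D : set R) (h : R -> 'cV[C]_m) : Prop :=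
  forall i : 'I_m, L2c D (fun x => h x i ord0).

Definition Cint (D : set R) (h : R -> C) : C :=
  Complex (Rintegral mu D (fun x => complex.Re (h x)))
          (Rintegral mu D (fun x => complex.Im (h x))).

Definition CVint m (D : set R) (h : R -> 'cV[C]_m) : 'cV[C]_m :=
  \col_i Cint D (fun x => h x i ord0).

Definition H1 m (a b : R) (g : R -> 'cV[C]_m) : Prop :=
  exists gd : R -> 'cV[C]_m, L2v `[a, b] gd /\
    forall t, a <= t <= b -> g t = g a + CVint `[a, t] gd.

Definition cmx p q (M : 'M[R]_(p, q)) : 'M[C]_(p, q) :=
  map_mx (fun x => (x%:C)%C) M.

Definition is_solution n r (Am1 : 'M[R]_n) (B : 'M[R]_(n, r))
  (A2 A3 : R -> 'M[C]_n) (T : R) (u : R -> 'cV[C]_r) (z : R -> 'cV[C]_n) : Prop :=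
  exists zd : R -> 'cV[C]_n,
    [/\ L2v `[-1, T] zd,
        (forall t, -1 <= t <= 0 -> z t = 0),
        (forall t, -1 <= t <= T -> z t = CVint `[-1, t] zd) &
        {ae mu, forall t, 0 <= t <= T ->
           zd t = cmx Am1 *m zd (t - 1)
                  + CVint `[-1, 0] (fun th => A2 th *m zd (t + th))
                  + CVint `[-1, 0] (fun th => A3 th *m z (t + th))
                  + cmx B *m u t}].

(* exact controllability at time T: the set of restrictions to [T-1,T] of
   solutions with zero initial data, over all controls u in L_2(0,T;C^r),
   equals H^1(T-1,T;C^n). Functions are compared via their restriction to
   [T-1,T] (both predicates only depend on the values on [T-1,T]). *)
Definition exactly_controllable n r (Am1 : 'M[R]_n) (B : 'M[R]_(n, r))
  (A2 A3 : R -> 'M[C]_n) (T : R) : Prop :=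
  [set g : R -> 'cV[C]_n | exists (u : R -> 'cV[C]_r) (z : R -> 'cV[C]_n),
      [/\ L2v `[0, T] u, is_solution Am1 B A2 A3 T u z &
          forall t, T - 1 <= t <= T -> g t = z t]]
  = [set g : R -> 'cV[C]_n | H1 (T - 1) T g].

End NeutralDefs.

(* Main.v *)
Require Import Defs.
From HB Require Import structures.
From mathcomp Require Import all_boot all_order all_algebra.
From mathcomp Require Import all_classical all_reals all_analysis.
From mathcomp Require Import complex measurable_realfun lra.
Import Order.TTheory GRing.Theory Num.Theory.
Import numFieldNormedType.Exports.
Local Open Scope ring_scope.

(** If [(A_{-1}, B)] is not controllable, some nonzero row [w] satisfies
    [w A_{-1}^k B = 0] for every [k].  Multiplying the equation by [w] removes
    the control: [w z'(t) = (w A_{-1}) z'(t - 1) + f_w(t)], where [f_w] pairs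
    square integrable functions and is therefore bounded.  Since [z'] vanishes
    on [[-1, 0]] and [w A_{-1}] has the same property as [w], stepping forward
    by unit intervals shows that [w z'] is essentially bounded on [[-1, T]].
    But [H^1(T - 1, T)] contains functions [g] with [w g'] unbounded, for
    instance [g'(s) = (s - T + 1)^(-1/4) w^T]. *)

(** * Translation invariance of Lebesgue measure *)

Section Translation.
Local Open Scope classical_set_scope.
Context {R : realType}.
Local Notation mu := (@lebesgue_measure R).

Lemma measurable_translation (c : R) :
  measurable_fun [set: R] (fun x : R => x + c).
Proof. exact: measurable_funD. Qed.

(** Translation keeps the length of half-open intervals, and a measure that agrees with Lebesgue
    measure on these is Lebesgue measure. This is applied to the pushforward [nu] under the
    translation. *)
Lemma lebesgue_measure_translation (c : R) (A : set R) :
  measurable A -> mu ((fun x => x + c) @^-1` A) = mu A.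
Proof.
move=> mA; apply/esym.
pose phi (x : measurableTypeR R) : measurableTypeR R := x + c.
have mphi : measurable_fun [set: measurableTypeR R] phi.
  exact: measurable_translation.
pose nu := (pushforward mu phi :
  {measure set (measurableTypeR R) -> \bar R}).
suff /(_ A mA) : forall A, measurable A -> mu A = nu mphi A by [].
apply: lebesgue_measure_unique => X /ocitvP[->|[[a b] /= ab ->]].
  by rewrite !measure0.
rewrite /nu /= /pushforward.
have -> : (fun x : R => x + c) @^-1` `]a, b] = `]a - c, b - c].
  by apply/seteqP; split => x /=; rewrite !in_itv/= ltrBlDr lerBrDr.
rewrite -/mu !lebesgue_measure_itv/= !lte_fin ltrD2r ab -!EFinD.
by congr EFin; rewrite opprB addrA subrK.
Qed.

Lemma ae_translation (c : R) (P : R -> Prop) :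
  {ae mu, forall t, P t} -> {ae mu, forall t, P (t + c)}.
Proof.
move=> [N [mN N0 PN]]; exists ((fun x => x + c) @^-1` N); split.
- by rewrite -[X in measurable X]setTI; exact: measurable_translation.
- by rewrite [LHS]lebesgue_measure_translation.
- by move=> x /= nP; exact: PN.
Qed.

Lemma ge0_integral_translation (c : R) (D : set R) (f : R -> \bar R) :
  measurable D -> measurable_fun D f -> (forall x, D x -> 0 <= f x)%E ->
  (\int[mu]_(x in D) f x =
   \int[mu]_(x in (fun x => (x + c)%R) @^-1` D) f (x + c)%R)%E.
Proof.
move=> mD mf f0.
have f0' : {in D, forall y, (0 <= f y)%E} by move=> x /set_mem /f0.
apply: etrans (@ge0_integral_pushforward _ _ (measurableTypeR R)
  (measurableTypeR R) R _ (measurable_translation c) mu D f mD mf f0').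
apply: eq_measure_integral => [|mphi A mA _].
  exact: measurable_translation.
exact/esym/lebesgue_measure_translation.
Qed.

End Translation.

(** * Bounds on integrals by domination *)

Section Domination.
Local Open Scope classical_set_scope.
Context d (T : measurableType d) (R : realType).
Variable mu : {measure set T -> \bar R}.

(* Unlike [ge0_le_integral], no measurability is assumed. *)
Lemma ge0_le_integral_dom (D : set T) (f g : T -> \bar R) :
  (forall x, D x -> 0 <= f x <= g x)%E ->
  (\int[mu]_(x in D) f x <= \int[mu]_(x in D) g x)%E.
Proof.
move=> fg; rewrite integral_mkcond [leRHS]integral_mkcond.
rewrite !ge0_integralTE; last 2 first.
- by apply: erestrict_ge0 => x /fg /andP[+]; exact: le_trans.
- by apply: erestrict_ge0 => x /fg /andP[].
apply: le_ereal_sup => _ [h hf <-]; exists h => // x.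
apply: le_trans (hf x) _; apply: lee_restrict => {}x /fg /andP[] //.
Qed.

(** The positive and the negative part of [f] are both dominated by [g], so their integrals lie
    between 0 and [M] and differ by at most [M]. *)
Lemma norm_Rintegral_le (D : set T) (f g : T -> R) (M : R) :
  (forall x, D x -> `|f x| <= g x) ->
  (\int[mu]_(x in D) (g x)%:E <= M%:E)%E ->
  `|Rintegral mu D f| <= M.
Proof.
move=> fg gM; rewrite /Rintegral integralE.
set p := (X in (X - _)%E); set q := (X in (_ - X)%E).
have p0 : (0 <= p)%E by apply: integral_ge0 => x _; exact: funepos_ge0.
have q0 : (0 <= q)%E by apply: integral_ge0 => x _; exact: funeneg_ge0.
have pM : (p <= M%:E)%E.
  apply: le_trans gM; apply: ge0_le_integral_dom => x /fg fgx.
  rewrite funepos_ge0 funeposE /= -EFin_max lee_fin ge_max.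
  by rewrite (le_trans (ler_norm _) fgx) (le_trans (normr_ge0 _) fgx).
have qM : (q <= M%:E)%E.
  apply: le_trans gM; apply: ge0_le_integral_dom => x /fg fgx.
  rewrite funeneg_ge0 funenegE /= -EFin_max lee_fin ge_max.
  by rewrite (le_trans (ler_norm _) _) ?normrN// (le_trans (normr_ge0 _) fgx).
case: p p0 pM => [p| |]//; case: q q0 qM => [q| |]//=.
rewrite !lee_fin => q0 qM p0 pM; rewrite ler_norml; apply/andP; split.
  by rewrite lerBrDl; apply: le_trans p0; rewrite subr_le0.
by rewrite lerBlDr (le_trans pM)// lerDl.
Qed.

End Domination.

(** Rank deficiency gives a nonzero [w] in the left kernel of the block row, which settles the
    powers below [n]. By Cayley-Hamilton every other power of [A] is a combination of these. *)
Lemma uncontrollable_left_vector (F : fieldType) (n r : nat) (A : 'M[F]_n)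
    (B : 'M[F]_(n, r)) :
  (\rank (\mxrow_(k < n) (A ^+ k *m B)) < n)%N ->
  exists2 w : 'rV[F]_n, w != 0 & forall k : nat, w *m A ^+ k *m B = 0.
Proof.
case: n A B => [//|n] A B hrk.
set K := \mxrow_(k < n.+1) _ in hrk.
have /rowV0Pn[w /sub_kermxP wK w0] : kermx K != 0.
  by rewrite kermx_eq0 /row_free neq_ltn hrk.
exists w => // k.
have wB (i : 'I_n.+1) : w *m A ^+ i *m B = 0.
  move: wK; rewrite mul_mxrow.
  have -> : 0 = \mxrow_(k < n.+1) (0 : 'M[F]_(1, r)).
    by apply/matrixP => a b; rewrite !mxE.
  by move/eq_mxrowP => /(_ i); rewrite mulmxA.
(* The remainder [q] has at most [n.+1] coefficients, so [horner_mx A q] involves only the powers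
   covered by [wB]. *)
set q := 'X^k %% char_poly A.
have Ak : A ^+ k = horner_mx A q.
  rewrite -{1}[A]horner_mx_X -rmorphXn /= {1}(divp_eq 'X^k (char_poly A)).
  by rewrite rmorphD rmorphM /= Cayley_Hamilton mulr0 add0r.
have sq : (size q <= n.+1)%N.
  by rewrite -ltnS -(size_char_poly A) ltn_modp monic_neq0 ?char_poly_monic.
rewrite Ak -(take_poly_id sq) /take_poly poly_def rmorph_sum /= mulmx_sumr.
rewrite mulmx_suml big1 // => i _.
rewrite linearZ /= rmorphXn /= horner_mx_X -scalemxAr -scalemxAl.
by rewrite wB scaler0.
Qed.

#[local] Instance lebesgue_ae_filter (R : realType) :
  Filter (nbhs (almost_everywhere (@lebesgue_measure R))).
Proof. exact: (ae_filter_ringOfSetsType (@lebesgue_measure R)). Qed.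

(** * Square integrable functions and their primitives *)

Section SquareIntegrable.
Local Open Scope classical_set_scope.
Context {R : realType}.
Local Notation mu := (@lebesgue_measure R).

Lemma measurable_sqr (D : set R) (f : R -> R) :
  measurable_fun D f -> measurable_fun D (fun x => ((f x) ^+ 2)%:E).
Proof. by move=> mf; apply/measurable_EFinP; exact: measurable_funX. Qed.

Lemma measurable_fun_translation (c : R) (D E : set R) (f : R -> R) :
  measurable D -> measurable_fun D f -> (forall x, E x -> D (x + c)) ->
  measurable_fun E (fun x => f (x + c)).
Proof.
move=> mD mf ED; apply: (measurable_comp mD) => //.
  by move=> _ [x Ex <-]; exact: ED.
exact: measurable_funS (measurable_translation c).
Qed.

(** A change of variables turns the right-hand side into an integral over the preimage of [D], which
    contains [E]. *)
Lemma integral_sqr_translation_le (c : R) (D E : set R) (f : R -> R) :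
  measurable D -> measurable E -> measurable_fun D f ->
  (forall x, E x -> D (x + c)) ->
  (\int[mu]_(x in E) ((f (x + c)) ^+ 2)%:E <=
   \int[mu]_(x in D) ((f x) ^+ 2)%:E)%E.
Proof.
move=> mD mE mf ED.
rewrite (ge0_integral_translation c D)//; last 2 first.
- exact: measurable_sqr.
- by move=> x _; rewrite lee_fin sqr_ge0.
have mpre : measurable ((fun x => x + c) @^-1` D).
  by rewrite -[X in measurable X]setTI; exact: measurable_translation.
apply: ge0_subset_integral => //.
- by apply: measurable_sqr; apply: (measurable_fun_translation c D).
- by move=> x _; rewrite lee_fin sqr_ge0.
Qed.

Lemma L2r_integrable (a b : R) (f : R -> R) :
  L2r `[a, b] f -> mu.-integrable `[a, b] (EFin \o f).
Proof.
move=> [mf foo]; apply/integrableP; split; first exact/measurable_EFinP.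
apply: (@le_lt_trans _ _
  (\int[mu]_(x in `[a, b]) (1%:E + ((f x) ^+ 2)%:E))%E).
  apply: ge0_le_integral_dom => x _; rewrite abse_ge0 /= -EFinD lee_fin.
  have : 0 <= (`|f x| - 1) ^+ 2 by exact: sqr_ge0.
  have : `|f x| ^+ 2 = f x ^+ 2 by rewrite real_normK// num_real.
  by have := normr_ge0 (f x); nra.
rewrite ge0_integralD//; last 2 first.
- by move=> x _; rewrite lee_fin sqr_ge0.
- exact: measurable_sqr.
rewrite lte_add_pinfty// integral_cst// mul1e [ltLHS]lebesgue_measure_itv /=.
by case: ifP => _; rewrite ?ltry// -EFinD ltry.
Qed.

(** The primitive of an integrable function is continuous, so its square is continuous on a compact
    interval and hence integrable. *)
Lemma L2r_primitive (a b : R) (f : R -> R) : a <= b -> L2r `[a, b] f ->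
  L2r `[a, b] (fun t => Rintegral mu `[a, t] f).
Proof.
move=> ab /L2r_integrable intf.
have cF := parameterized_integral_continuous ab intf.
split; first exact: subspace_continuous_measurable_fun.
have cF2 : {within `[a, b],
    continuous (fun t => (Rintegral mu `[a, t] f) ^+ 2)}.
  move=> x; apply: (@continuous_comp (subspace `[a, b]) R R
    (fun t => Rintegral mu `[a, t] f) (fun y => y ^+ 2)); first exact: cF.
  exact: exprn_continuous.
have /integrableP[_] := continuous_compact_integrable (@segment_compact _ a b) cF2.
apply: le_lt_trans; rewrite le_eqVlt; apply/orP; left; apply/eqP.
by apply: eq_integral => x _ /=; rewrite ger0_norm// sqr_ge0.
Qed.

Lemma ae_neq (c : R) : {ae mu, forall t, t != c}.
Proof.
exists [set c]; split => //; first by rewrite lebesgue_measure_set1.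
by move=> t /= /negP; rewrite negbK => /eqP.
Qed.

Lemma ae_derive_primitive (a b : R) (f : R -> R) :
  mu.-integrable `[a, b] (EFin \o f) ->
  {ae mu, forall t, a < t < b ->
    is_derive t 1 (fun y => Rintegral mu `[a, y] f) (f t)}.
Proof.
move=> intf; have mab : measurable `[a, b] by [].
(* [FTC1] is applied with integrability up to every [y], hence the extension of [f] by zero. Its
   primitive agrees with that of [f] near each point strictly between [a] and [b]. *)
have intg : mu.-integrable setT (EFin \o (f \_ `[a, b])).
  by move: (intf); rewrite integrable_mkcond//= (restrict_EFin f).
have intgS y : mu.-integrable `[a, y] (EFin \o (f \_ `[a, b])).
  exact: integrableS intg.
have := @FTC1 _ (f \_ `[a, b]) (BLeft a) intgS (integrable_locally mab intf).
set F := fun y => _; apply: filterS => t dF /andP[at_ tb].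
have {dF}[] : derivable F t 1 /\ F^`() t = (f \_ `[a, b]) t.
  by apply: dF; rewrite /= lte_fin.
rewrite derive1E => dF DF.
have FE : \near t, F t = Rintegral mu `[a, t] f.
  near=> y; rewrite /F; apply: eq_Rintegral => x /set_mem/=; rewrite in_itv/=.
  move=> /andP[ax xy]; rewrite patchE ifT// inE/= in_itv/= ax/= (le_trans xy)//.
  by apply/ltW; near: y; exact: lt_nbhsl.
have -> : f t = (f \_ `[a, b]) t.
  by rewrite patchE ifT// inE/= in_itv/= !ltW.
apply: DeriveDef; first exact: near_eq_derivable FE dF.
by rewrite -DF; apply/esym/near_eq_derive.
Unshelve. all: by end_near. Qed.

(** Almost everywhere a primitive has its integrand as derivative, and a constant does not affect
    it. The two base points allow comparing a solution integrated from [-1] with a target integrated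
    from [T - 1]. *)
Lemma ae_eq_of_primitive (a0 a b k : R) (f g : R -> R) : a0 <= a ->
  mu.-integrable `[a0, b] (EFin \o f) -> mu.-integrable `[a, b] (EFin \o g) ->
  (forall t, a <= t <= b ->
     Rintegral mu `[a0, t] f = k + Rintegral mu `[a, t] g) ->
  {ae mu, forall t, a <= t <= b -> f t = g t}.
Proof.
move=> a0a /ae_derive_primitive df /ae_derive_primitive dg fg.
(* The identity is known only between [a] and [b], so differentiating it needs an interior point;
   the two endpoints form a null set. *)
apply: filterS2 (filterI df dg) (filterI (ae_neq a) (ae_neq b)).
move=> t [{}df {}dg] [ta tb] /andP[at_ tb_].
have {}at_ : a < t by rewrite lt_neqAle eq_sym ta.
have {}tb_ : t < b by rewrite lt_neqAle tb.
have {}df := df (introT andP (conj (le_lt_trans a0a at_) tb_)).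
have {}dg := dg (introT andP (conj at_ tb_)).
have E : \near t, Rintegral mu `[a0, t] f = k + Rintegral mu `[a, t] g.
  near=> y; apply: fg; apply/andP; split; apply/ltW.
    by near: y; exact: lt_nbhsr.
  by near: y; exact: lt_nbhsl.
have dh : is_derive t 1 (fun y => k + Rintegral mu `[a, y] g) (0 + g t).
  exact: is_deriveD.
rewrite -[RHS]add0r -(@derive_val _ _ _ _ _ _ _ df).
rewrite -(@derive_val _ _ _ _ _ _ _ dh).
exact: near_eq_derive.
Unshelve. all: by end_near. Qed.

End SquareIntegrable.

(** * A square integrable function that blows up at a point *)

Section UnboundedSquareIntegrable.
Local Open Scope classical_set_scope.
Context {R : realType}.
Local Notation mu := (@lebesgue_measure R).

(** The antiderivative, twice the square root, is 2 at 1 and nonnegative at [e], so the bound is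
    uniform in [e]. *)
Lemma integral_powRNhalf_le (e : R) : 0 < e < 1 ->
  (\int[mu]_(x in `[e, 1%R]) (x `^ (- 2^-1))%:E <= 2%:E)%E.
Proof.
move=> /andP[e0 e1].
have gt0 x : `[e, 1] x -> 0 < x.
  by rewrite /= in_itv/= => /andP[+ _]; exact: lt_le_trans.
have dF r x : 0 < x -> derivable (fun y : R => y `^ r) x 1.
  by move=> x0; apply: derivable_powR; rewrite in_itv/= x0.
have cts r x : 0 < x -> {for x, continuous (fun y : R => y `^ r)}.
  move=> x0.
  by apply: differentiable_continuous; apply/derivable1_diffP; exact: dF.
have within_powR r : {within `[e, 1], continuous (fun y : R => y `^ r)}.
  by apply: continuous_in_subspaceT => x /set_mem /gt0; exact: cts.
rewrite (@continuous_FTC2 _ _ (fun x => 2 * x `^ 2^-1) _ _ e1) //.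
- by rewrite -EFinB lee_fin powR1 mulr1 gerBl mulr_ge0// powR_ge0.
- split.
  + move=> x; rewrite in_itv/= => /andP[ex _].
    by apply: derivableM => //; apply: dF; exact: lt_trans ex.
  + apply: cvg_at_right_filter; apply: cvgM; first exact: cvg_cst.
    exact: cts.
  + apply: cvg_at_left_filter; apply: cvgM; first exact: cvg_cst.
    exact: cts.
- move=> x; rewrite in_itv/= => /andP[ex _].
  have x0 : 0 < x by exact: lt_trans ex.
  rewrite derive1E deriveZ/=; last exact: dF.
  rewrite -derive1E powR_derive1 ?in_itv/= ?x0//.
  rewrite /GRing.scale/= mulrA divff// mul1r; congr (_ `^ _); lra.
Qed.

(** The square is the power -1/2, whose integrals over the sets [I k] are at most 2. These sets
    increase to the interval without its endpoint 0, so monotone convergence applies. *)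
Lemma L2r_powRNquarter : L2r `[0, 1] (fun x : R => x `^ (- 4^-1)).
Proof.
split; first exact: measurable_funTS (measurable_powR _).
have msq : measurable_fun [set: R] (fun x : R => ((x `^ (- 4^-1)) ^+ 2)%:E).
  by apply: measurable_sqr; exact: measurable_powR.
(* The shift by 2 keeps the left endpoint strictly below 1, as the previous bound requires. *)
pose I (k : nat) : set R := `[k.+2%:R^-1, 1].
rewrite -integral_itv_obnd_cbnd; last first.
  exact: measurable_funTS msq.
have IU : `]0%R, 1%R] = \bigcup_k I k.
  apply/seteqP; split => x /=; rewrite in_itv/=.
    move=> /andP[x0 x1]; exists (Num.truncn x^-1) => //.
    rewrite /I/= in_itv/= x1 andbT invf_ple ?posrE//.
    apply: le_trans (ltW (truncnS_gt _)) _.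
    by rewrite ler_nat.
  move=> [k _]; rewrite /I/= in_itv/= => /andP[kx ->]; rewrite andbT.
  by apply: lt_le_trans kx; rewrite invr_gt0.
rewrite IU.
have cvgI : (\int[mu]_(x in I k) ((x `^ (- 4^-1)) ^+ 2)%:E)%E @[k --> \oo] -->
    (\int[mu]_(x in \bigcup_k I k) ((x `^ (- 4^-1)) ^+ 2)%:E)%E.
  apply: ge0_nondecreasing_set_cvg_integral.
  - move=> m k mk; apply/subsetPset => x; rewrite /I/= !in_itv/= => /andP[+ ->].
    rewrite andbT; apply: le_trans; rewrite lef_pV2 ?posrE// ler_nat.
    by rewrite !ltnS.
  - by move=> k; exact: measurable_itv.
  - by move=> k; exact: measurable_funTS.
  - by move=> k x _; rewrite lee_fin sqr_ge0.
rewrite -(cvg_lim _ cvgI)//.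
apply: (@le_lt_trans _ _ 2%:E); last exact: ltry.
apply: lime_le; first by apply/cvg_ex; eexists; exact: cvgI.
apply: nearW => k.
have k1 : 0 < (k.+2%:R^-1 : R) < 1.
  by rewrite invr_gt0 ltr0n/= invf_lt1// ltr1n.
apply: le_trans (integral_powRNhalf_le _ k1); rewrite le_eqVlt; apply/orP; left.
apply/eqP/eq_integral => x _; congr EFin.
rewrite -powR_mulrn ?powR_ge0// -powRrM; congr (_ `^ _); lra.
Qed.

(** Largeness is stated on a whole right neighbourhood of [a], which has positive measure, so that
    it can contradict an almost everywhere bound. *)
Lemma exists_unbounded_L2r (a : R) : exists2 q : R -> R, L2r `[a, a + 1] q &
  forall M, exists2 e, 0 < e & forall s, a < s < a + e -> M < q s.
Proof.
pose p (x : R) := x `^ (- 4^-1).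
have [mp poo] : L2r `[0, 1] p := L2r_powRNquarter.
have shift s : `[a, a + 1] s -> `[0, 1] (s + - a).
  by rewrite /= !in_itv/= subr_ge0 lerBlDl.
exists (fun s => p (s + - a)).
  split; first exact: measurable_fun_translation mp shift.
  by apply: le_lt_trans poo; exact: integral_sqr_translation_le.
(* [K] is a positive substitute for [M]; for [x > 0] the power -1/4 of [x] exceeds [K] when
   [x < K ^- 4]. *)
move=> M; pose K := Num.max M 1.
have K0 : 0 < K by rewrite lt_max ltr01 orbT.
exists (K ^- 4); first by rewrite invr_gt0 exprn_gt0.
move=> s /andP[sa se]; apply: (@le_lt_trans _ _ K).
  by rewrite le_max lexx.
have x0 : 0 < s - a by rewrite subr_gt0.
rewrite /p powRN -[ltLHS]invrK ltf_pV2 ?posrE ?invr_gt0 ?powR_gt0//.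
have -> : K^-1 = (K ^- 4) `^ 4^-1.
  rewrite -exprVn -powR_mulrn ?invr_ge0 ?ltW// -powRrM divff// powRr1//.
  by rewrite invr_ge0 ltW.
apply: gt0_ltr_powR; rewrite ?invr_gt0// ?nnegrE ?invr_ge0 ?exprn_ge0 ?ltW//.
by rewrite ltrBlDl.
Qed.

Lemma ae_exists_itv (a b : R) (P : R -> Prop) : a < b ->
  {ae mu, forall t, P t} -> exists2 t, a < t < b & P t.
Proof.
move=> ab [N [mN N0 PN]]; apply: contrapT => nP.
have : (mu `]a, b[ <= mu N)%E.
  apply: le_measure; rewrite ?inE// => t /=; rewrite in_itv/= => tab.
  by apply: PN => Pt; apply: nP; exists t.
rewrite N0 lebesgue_measure_itv/= lte_fin ab -EFinD lee_fin.
by apply/negP; rewrite -ltNge subr_gt0.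
Qed.

End UnboundedSquareIntegrable.

(** * Essential boundedness of the projected derivative *)

Section LeftProjection.
Local Open Scope classical_set_scope.
Context {R : realType}.
Local Notation C := (complex R).
Local Notation mu := (@lebesgue_measure R).

(** A crude Young inequality: it separates the two factors, so that only integrals of squares have
    to be estimated later. *)
Lemma norm_Re_mul_le (x y : C) : `|complex.Re (x * y)| <=
  (complex.Re x ^+ 2 + complex.Im x ^+ 2) +
  (complex.Re y ^+ 2 + complex.Im y ^+ 2).
Proof.
case: x => a b; case: y => c d /=; rewrite ler_norml.
have := sqr_ge0 (a + c); have := sqr_ge0 (a - c).
have := sqr_ge0 (b + d); have := sqr_ge0 (b - d).
by move=> *; apply/andP; split; nra.
Qed.

Lemma norm_Re_mulmx_le (m n : nat) (A : 'M[C]_(m, n)) (x : 'cV[C]_n) i :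
  `|complex.Re ((A *m x) i ord0)| <=
  \sum_j ((complex.Re (A i j) ^+ 2 + complex.Im (A i j) ^+ 2) +
          (complex.Re (x j ord0) ^+ 2 + complex.Im (x j ord0) ^+ 2)).
Proof.
rewrite mxE raddf_sum; apply: le_trans (ler_norm_sum _ _ _) _.
by apply: ler_sum => j _; exact: norm_Re_mul_le.
Qed.

Lemma Re_cmx_mulmx (n : nat) (w : 'rV[R]_n) (v : 'cV[C]_n) :
  complex.Re ((cmx w *m v) ord0 ord0) = \sum_i w ord0 i * complex.Re (v i ord0).
Proof.
rewrite mxE raddf_sum; apply: eq_bigr => i _; rewrite mxE /=.
by case: (v i ord0) => a b /=; rewrite mul0r subr0.
Qed.

(** The window [t + th] stays inside the interval from [-1] to [T], so the squares of [x] contribute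
    at most their integral over that interval. The bound [S] is therefore independent of [t]. *)
Lemma Re_integral_mulmx_bounded (n : nat) (T : R) (A : R -> 'M[C]_n)
    (x : R -> 'cV[C]_n) (i : 'I_n) :
  (forall i j, L2c `[-1, 0] (fun th => A th i j)) -> L2v `[-1, T] x ->
  exists M, forall t, 0 <= t <= T ->
    `|complex.Re (CVint `[-1, 0] (fun th => A th *m x (t + th)) i ord0)| <= M.
Proof.
move=> hA hx.
pose S := (\sum_(j < n)
  ((\int[mu]_(th in `[(-1)%R, 0%R]) (complex.Re (A th i j) ^+ 2)%:E +
    \int[mu]_(th in `[(-1)%R, 0%R]) (complex.Im (A th i j) ^+ 2)%:E) +
   (\int[mu]_(s in `[(-1)%R, T]) (complex.Re (x s j ord0) ^+ 2)%:E +
    \int[mu]_(s in `[(-1)%R, T]) (complex.Im (x s j ord0) ^+ 2)%:E)))%E.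
have S0 : (0 <= S)%E.
  apply: sume_ge0 => j _; apply: adde_ge0; apply: adde_ge0;
    by apply: integral_ge0 => s _; rewrite lee_fin sqr_ge0.
have Soo : (S < +oo)%E.
  apply: lte_sum_pinfty => j _.
  have [[_ ?] [_ ?]] := hA i j; have [[_ ?] [_ ?]] := hx j.
  by apply: lte_add_pinfty; apply: lte_add_pinfty.
exists (fine S) => t /andP[t0 tT].
rewrite mxE /=; apply: norm_Rintegral_le.
  by move=> th _; rewrite [t + th]addrC; exact: norm_Re_mulmx_le.
rewrite fineK ?ge0_fin_numE//.
have shift (th : R) : `[-1, 0] th -> `[-1, T] (th + t).
  by rewrite /= !in_itv/= => /andP[? ?]; apply/andP; split; lra.
have mA (j : 'I_n) :
    measurable_fun (`[-1, 0] : set R) (fun th : R => complex.Re (A th i j)) /\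
    measurable_fun (`[-1, 0] : set R) (fun th : R => complex.Im (A th i j)).
  by have [[? _] [? _]] := hA i j.
have mx (j : 'I_n) :
    measurable_fun (`[-1, 0] : set R)
      (fun th : R => complex.Re (x (th + t) j ord0)) /\
    measurable_fun (`[-1, 0] : set R)
      (fun th : R => complex.Im (x (th + t) j ord0)).
  have [[mr _] [mi _]] := hx j; split.
  - exact: (measurable_fun_translation t `[-1, T] _ _ _ mr).
  - exact: (measurable_fun_translation t `[-1, T] _ _ _ mi).
under eq_integral do rewrite -sumEFin.
rewrite ge0_integral_sum//; last 2 first.
- move=> j; have [? ?] := mA j; have [? ?] := mx j.
  by apply/measurable_EFinP; do ! apply: measurable_funD; exact: measurable_funX.
- by move=> j th _; rewrite lee_fin !addr_ge0 ?sqr_ge0.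
apply: lee_sum => j _; have [? ?] := mA j; have [? ?] := mx j.
under eq_integral do rewrite !EFinD.
rewrite ge0_integralD//; last 4 first.
- by move=> th _; rewrite -EFinD lee_fin addr_ge0 ?sqr_ge0.
- by apply: emeasurable_funD; exact: measurable_sqr.
- by move=> th _; rewrite -EFinD lee_fin addr_ge0 ?sqr_ge0.
- by apply: emeasurable_funD; exact: measurable_sqr.
rewrite !ge0_integralD//; try exact: measurable_sqr;
  try by move=> th _; rewrite lee_fin sqr_ge0.
apply: leeD => //; have [[mr _] [mi _]] := hx j; apply: leeD.
- exact: (integral_sqr_translation_le t `[-1, T] _
    (fun s => complex.Re (x s j ord0))).
- exact: (integral_sqr_translation_le t `[-1, T] _
    (fun s => complex.Im (x s j ord0))).
Qed.

Lemma L2v_primitive (n : nat) (a b : R) (x : R -> 'cV[C]_n) : a <= b ->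
  L2v `[a, b] x -> L2v `[a, b] (fun t => CVint `[a, t] x).
Proof.
move=> ab hx j.
have -> : (fun t => CVint `[a, t] x j ord0) =
    (fun t => Cint `[a, t] (fun s => x s j ord0)).
  by apply/funext => t; rewrite mxE.
by have [? ?] := hx j; split; exact: L2r_primitive.
Qed.

Lemma L2v_Re_integrable (n : nat) (a b c d : R) (x : R -> 'cV[C]_n) (i : 'I_n) :
  L2v `[a, b] x -> a <= c -> d <= b ->
  mu.-integrable `[c, d] (EFin \o (fun t => complex.Re (x t i ord0))).
Proof.
move=> hx ac db; have [/L2r_integrable + _] := hx i; apply: integrableS => //.
by apply: subset_itv; rewrite bnd_simp.
Qed.

Lemma ae_zero_history (n : nat) (T : R) (zd z : R -> 'cV[C]_n) : 0 <= T ->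
  L2v `[-1, T] zd -> (forall t, -1 <= t <= 0 -> z t = 0) ->
  (forall t, -1 <= t <= T -> z t = CVint `[-1, t] zd) ->
  {ae mu, forall t, -1 <= t <= 0 -> forall i, complex.Re (zd t i ord0) = 0}.
Proof.
move=> T0 hzd z0 zE.
have : {ae mu, forall t, forall i, -1 <= t <= 0 -> complex.Re (zd t i ord0) = 0}.
  apply: filter_forall => i.
  apply: (@ae_eq_of_primitive _ (-1) (-1) 0 0 _ (fun=> 0)) => //.
  - exact: L2v_Re_integrable hzd _ T0.
  - exact: integrable0.
  - move=> t /andP[t1 t0]; rewrite add0r [RHS](_ : _ = 0); last first.
      by rewrite /Rintegral integral0.
    have tT : -1 <= t <= T by rewrite t1 (le_trans t0).
    have := congr1 (fun v : 'cV_n => complex.Re (v i ord0)) (zE t tT).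
    by rewrite z0 ?t1// !mxE /= => <-.
by apply: filterS => t ht tI i; exact: ht.
Qed.

(** Only real parts are followed: [w] and [Am1] are real, and the target that will contradict the
    bound is real too. *)
Lemma left_projection_ess_bounded (n r : nat) (Am1 : 'M[R]_n) (B : 'M[R]_(n, r))
    (A2 A3 : R -> 'M[C]_n) (T : R) (u : R -> 'cV[C]_r) (z zd : R -> 'cV[C]_n)
    (w : 'rV[R]_n) :
  (forall i j, L2c `[-1, 0] (fun th => A2 th i j)) ->
  (forall i j, L2c `[-1, 0] (fun th => A3 th i j)) ->
  0 <= T -> L2v `[-1, T] zd -> (forall t, -1 <= t <= 0 -> z t = 0) ->
  (forall t, -1 <= t <= T -> z t = CVint `[-1, t] zd) ->
  {ae mu, forall t, 0 <= t <= T ->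
     zd t = cmx Am1 *m zd (t - 1)
            + CVint `[-1, 0] (fun th => A2 th *m zd (t + th))
            + CVint `[-1, 0] (fun th => A3 th *m z (t + th))
            + cmx B *m u t} ->
  (forall k : nat, w *m Am1 ^+ k *m B = 0) ->
  exists M, {ae mu, forall t, -1 <= t <= T ->
    `|complex.Re ((cmx w *m zd t) ord0 ord0)| <= M}.
Proof.
move=> hA2 hA3 T0 hzd z0 zE eqn wB.
(* The [A3] term is bounded through the primitive of [zd], which coincides with [z] between [-1] and
   [T]. *)
have hz : L2v `[-1, T] (fun t => CVint `[-1, t] zd).
  by apply: L2v_primitive => //; lra.
have /choice[M2 M2P] : forall i, exists M, forall t, 0 <= t <= T ->
    `|complex.Re (CVint `[-1, 0] (fun th => A2 th *m zd (t + th)) i ord0)| <= M.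
  by move=> i; exact: Re_integral_mulmx_bounded.
have /choice[M3 M3P] : forall i, exists M, forall t, 0 <= t <= T ->
    `|complex.Re (CVint `[-1, 0] (fun th => A3 th *m z (t + th)) i ord0)| <= M.
  move=> i; have [M MP] := Re_integral_mulmx_bounded _ _ _ _ i hA3 hz.
  exists M => t /[dup] tT /MP; congr (`|complex.Re _| <= _).
  rewrite !mxE; congr Complex; apply: eq_Rintegral => th /set_mem /=;
    rewrite in_itv/= => thI; rewrite zE//; lra.
have zd0 := ae_zero_history _ _ _ _ T0 hzd z0 zE.
(* Induction on the right end [m] of the interval covered. [w] is generalised because going back one
   unit of time replaces it by [w *m Am1]. *)
suff step (m : nat) : forall w : 'rV[R]_n, (forall k, w *m Am1 ^+ k *m B = 0) ->
    exists M, {ae mu, forall t, -1 <= t <= T -> t <= m%:R ->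
      `|complex.Re ((cmx w *m zd t) ord0 ord0)| <= M}.
  have [M hM] := step (Num.truncn T).+1 w wB; exists M.
  apply: filterS hM => t ht /[dup] /andP[_ tT] /ht; apply.
  by apply: le_trans tT (ltW _); exact: truncnS_gt.
elim: m => [|m IH] {wB}w wB.
  exists 0; apply: filterS zd0 => t ht /andP[t1 _] t0.
  rewrite Re_cmx_mulmx big1 ?normr0// => i _.
  by rewrite ht ?mulr0// t1.
have [k|M hM] := IH (w *m Am1).
  by have := wB k.+1; rewrite exprS mulmxA.
(* The 0 serves [t <= 0], where the projection vanishes. For [t > 0], [M] bounds the term delayed to
   [t - 1] and the sum bounds the two integral terms weighted by [w]. *)
exists (Num.max 0 (M + \sum_i `|w ord0 i| * (M2 i + M3 i))).
apply: filterS3 zd0 eqn (ae_translation (-1) _ hM) => t ht et hMt tT tm.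
rewrite le_max; have [t0|t0] := leP t 0.
  rewrite Re_cmx_mulmx big1 ?normr0 ?lexx// => i _.
  by rewrite ht ?mulr0//; case/andP: tT => ->.
have tT' : 0 <= t <= T by lra.
apply/orP; right; rewrite et//.
set v2 := CVint _ _; set v3 := CVint _ _.
(* The control disappears because [w *m B = 0], the instance [k = 0] of [wB]. *)
have -> : cmx w *m (cmx Am1 *m zd (t - 1) + v2 + v3 + cmx B *m u t) =
    cmx (w *m Am1) *m zd (t - 1) + cmx w *m (v2 + v3).
  have cmxM p q s (X : 'M[R]_(p, q)) (Y : 'M[R]_(q, s)) :
      cmx (X *m Y) = cmx X *m cmx Y by exact: (map_mxM (real_complex R)).
  rewrite !mulmxDr !mulmxA -!cmxM.
  have := wB 0%N; rewrite expr0 mulmx1 => ->.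
  by rewrite /cmx map_mx0 mul0mx addr0 addrA.
rewrite mxE raddfD /=; apply: le_trans (ler_normD _ _) _.
apply: lerD; first by apply: hMt; rewrite ?lerBlDr ?natr1//; lra.
rewrite Re_cmx_mulmx; apply: le_trans (ler_norm_sum _ _ _) _.
apply: ler_sum => i _; rewrite normrM ler_wpM2l// mxE raddfD /=.
apply: le_trans (ler_normD _ _) _; apply: lerD; [exact: M2P|exact: M3P].
Qed.

End LeftProjection.

(** * An unreachable target in H^1 *)

Lemma L2rZ (R : realType) (D : set R) (c : R) (f : R -> R) : measurable D ->
  L2r D f -> L2r D (fun x => c * f x).
Proof.
move=> mD [mf foo]; split; first exact: measurable_funM.
under eq_integral do rewrite exprMn EFinM.
rewrite ge0_integralZl ?lee_fin ?sqr_ge0//.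
- by rewrite lte_mul_pinfty ?lee_fin ?sqr_ge0.
- exact: measurable_sqr.
- by move=> x _; rewrite lee_fin sqr_ge0.
Qed.

Lemma H1_primitive (R : realType) (m : nat) (a b : R)
    (gd : R -> 'cV[complex R]_m) :
  L2v `[a, b] gd -> H1 a b (fun t => CVint `[a, t] gd).
Proof.
move=> hgd; exists gd; split => // t _.
suff -> : CVint `[a, a] gd = 0 by rewrite add0r.
by apply/matrixP => i j; rewrite set_itv1 !mxE /Cint !Rintegral_set1.
Qed.

Lemma row_sqr_sum_gt0 (R : realType) (n : nat) (w : 'rV[R]_n) :
  w != 0 -> 0 < \sum_i w ord0 i ^+ 2.
Proof.
move=> /rV0Pn[j wj]; rewrite (bigD1 j)//= ltr_pwDl//.
  by rewrite exprn_even_gt0.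
by apply: sumr_ge0 => i _; exact: sqr_ge0.
Qed.

Theorem theorem3 (R : realType) (n r : nat) (hn : (0 < n)%N) (hr : (0 < r)%N)
  (Am1 : 'M[R]_n) (B : 'M[R]_(n, r)) (A2 A3 : R -> 'M[complex R]_n)
  (hA2 : forall i j, L2c `[-1, 0] (fun th => A2 th i j))
  (hA3 : forall i j, L2c `[-1, 0] (fun th => A3 th i j))
  (hnotctrl : (\rank (\mxrow_(k < n) (Am1 ^+ k *m B)) < n)%N) :
  forall T : R, 0 < T -> ~ exactly_controllable Am1 B A2 A3 T.
Proof.
move=> T T0 ctrl.
have [w w0 wB] := uncontrollable_left_vector _ _ _ _ _ hnotctrl.
have [q hq qoo] := exists_unbounded_L2r (T - 1); rewrite subrK in hq.
(* Multiplying by [w] gives [q s] times the positive squared norm of [w], so the projection inherits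
   the blow-up of [q] at [T - 1]. *)
pose gd s : 'cV[complex R]_n := \col_i ((w ord0 i * q s)%:C)%C.
have hgd : L2v `[T - 1, T] gd.
  move=> i; rewrite (_ : (fun s => _) = (fun s => ((w ord0 i * q s)%:C)%C)).
    split; first exact: L2rZ.
    split; first exact: measurable_cst.
    by under eq_integral do rewrite expr0n; rewrite integral0.
  by apply/funext => s; rewrite mxE.
have : H1 (T - 1) T (fun t => CVint `[T - 1, t] gd) by exact: H1_primitive.
rewrite -[H1 _ _ _]/([set g | H1 (T - 1) T g]%classic _) -ctrl.
move=> [u [z [_ [zd [hzd z0 zE eqn]] gz]]].
have [M hM] := left_projection_ess_bounded _ _ _ _ _ _ _ _ _ _ _
  hA2 hA3 (ltW T0) hzd z0 zE eqn wB.
(* The reached solution [z] and the target coincide from [T - 1] to [T], so their derivatives agree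
   almost everywhere there. *)
have zdE : {ae (@lebesgue_measure R), forall t, forall i, T - 1 <= t <= T ->
    complex.Re (zd t i ord0) = complex.Re (gd t i ord0)}.
  apply: filter_forall => i.
  apply: (@ae_eq_of_primitive _ (-1) (T - 1) T 0); first lra.
  - by apply: L2v_Re_integrable hzd _ _.
  - by apply: L2v_Re_integrable hgd _ _.
  - move=> t tT; have tT' : -1 <= t <= T by lra.
    have := congr1 (fun v : 'cV_n => complex.Re (v i ord0)) (gz t tT).
    by rewrite zE// !mxE add0r.
(* This level, multiplied by the squared norm of [w], is exactly the essential bound [M]. *)
have [e e0 qe] := qoo (M / \sum_i w ord0 i ^+ 2).
(* The minimum with 1 keeps [t] below [T], where both the bound [M] and the identification of [zd]
   with [gd] are available. *)
have [|t /andP[t1 t2] [/(_ _) Mt zt]] :=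
  ae_exists_itv (T - 1) (T - 1 + Num.min e 1) _ _ (filterI hM zdE).
  by rewrite ltrDl lt_min e0 ltr01.
have te : t < T - 1 + e by apply: lt_le_trans t2 _; rewrite lerD2l ge_min lexx.
have tT : t < T.
  by apply: lt_le_trans t2 _; rewrite -lerBrDl ge_min; apply/orP; right; lra.
have : `|complex.Re ((cmx w *m zd t) ord0 ord0)| <= M by apply: Mt; lra.
have -> : complex.Re ((cmx w *m zd t) ord0 ord0) = (\sum_i w ord0 i ^+ 2) * q t.
  rewrite Re_cmx_mulmx mulr_suml; apply: eq_bigr => i _.
  rewrite zt; last lra.
  by rewrite mxE /= mulrA -expr2.
apply/negP; rewrite -ltNge; apply: lt_le_trans (ler_norm _).
by rewrite mulrC -ltr_pdivrMr ?row_sqr_sum_gt0//; apply: qe; rewrite t1.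
Qed.
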